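(* The mapping $\Lambda^1 \colon \mathbf{Ring^1} \to \mathbf{Graph}$ that maps a unital ring $R$ to its unital compressed commuting graph $\Lambda^1(R)$, and a unital ring morphism $f \colon R \to S$ to the graph morphism $\Lambda^1(f) \colon \Lambda^1(R) \to \Lambda^1(S)$ given by $\Lambda^1(f)([r]_1) = [f(r)]_1$, is a (well defined) functor.
   Context: For a unital ring $R$ (associative; the zero ring is regarded as a unital ring with $1=0$) and $a \in R$, let $\langle a \rangle_1 = \{q(a) \mid q \in \mathbb{Z}[x]\}$ be the subring of $R$ generated by $1$ and $a$. Define an equivalence relation on $R$ by $a \sim_1 b$ if and only if $\langle a \rangle_1 = \langle b \rangle_1$, and let $[a]_1$ be the equivalence class of $a$. The unital compressed commuting graph $\Lambda^1(R)$ is the undirected graph whose vertex set is the set of all equivalence classes of elements of $R$ with respect to $\sim_1$, with an edge between $[a]_1$ and $[b]_1$ if and only if $ab=ba$ (loops are allowed; every vertex has a loop). $\mathbf{Ring^1}$ is the category of unital rings and unital ring homomorphisms. $\mathbf{Graph}$ is the category of undirected simple graphs that allow loops, with graph homomorphisms (maps of vertices sending adjacent vertices to adjacent vertices) as morphisms. *)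

(* Defs.v *)
From HB Require Import structures.
From mathcomp Require Import all_boot all_algebra.
From mathcomp Require Import boolp classical_sets.

Set Implicit Arguments.
Unset Strict Implicit.
Unset Printing Implicit Defensive.

Import GRing.Theory.

Local Open Scope classical_set_scope.
Local Open Scope ring_scope.

Record category := Category {
  obj :> Type;
  hom : obj -> obj -> Type;
  idc : forall A, hom A A;
  compc : forall A B C, hom B C -> hom A B -> hom A C;
  comp_idl : forall A B (f : hom A B), compc (idc B) f = f;
  comp_idr : forall A B (f : hom A B), compc f (idc A) = f;
  comp_assoc : forall A B C D (h : hom C D) (g : hom B C) (f : hom A B),
    compc h (compc g f) = compc (compc h g) f }.

Definition is_functor (C D : category) (F0 : C -> D)
    (F1 : forall A B : C, hom A B -> hom (F0 A) (F0 B)) : Prop :=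
  (forall A, F1 A A (idc A) = idc (F0 A)) /\
  (forall A B E (g : hom B E) (f : hom A B),
    F1 A E (compc g f) = compc (F1 B E g) (F1 A B f)).

Lemma rmorphism_ext (R S : pzRingType) (f g : {rmorphism R -> S}) :
  f =1 g -> f = g.
Proof.
case: f g => [f [cf1 cf2]] [g [cg1 cg2]] /= /funext fg.
case: _ / fg in cg1 cg2 *.
case: cf1 cg1 => a [] b; case: cf2 cg2 => c [] d.
by congr GRing.RMorphism.Pack; congr GRing.RMorphism.Class;
  [congr GRing.isNmodMorphism.Axioms_ | congr GRing.isMonoidMorphism.Axioms_];
  exact: Prop_irrelevance.
Qed.

(* pzRingType does not require 1 != 0, so the zero ring is an object. *)
Definition Ring1 : category.
Proof.
refine (@Category pzRingType (fun R S => {rmorphism R -> S})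
  (fun R => idfun) (fun R S T g f => g \o f) _ _ _).
- by move=> R S f; exact: rmorphism_ext.
- by move=> R S f; exact: rmorphism_ext.
- by move=> R S T U h g f; exact: rmorphism_ext.
Defined.

Record graph := MkGraph {
  vertex :> Type;
  adj : vertex -> vertex -> Prop;
  adj_sym : forall x y, adj x y -> adj y x }.

Record graph_hom (G H : graph) := GraphHom {
  graph_fun :> G -> H;
  graph_homP : forall x y, adj x y -> adj (graph_fun x) (graph_fun y) }.

Lemma graph_hom_ext (G H : graph) (f g : graph_hom G H) : f =1 g -> f = g.
Proof.
case: f g => [f pf] [g pg] /= /funext fg; case: _ / fg in pg *.
by congr GraphHom; exact: Prop_irrelevance.
Qed.

Definition graph_id (G : graph) : graph_hom G G :=
  GraphHom (fun x y (h : adj x y) => h).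

Definition graph_comp (G H K : graph) (g : graph_hom H K) (f : graph_hom G H) :
    graph_hom G K :=
  @GraphHom G K (fun x => g (f x))
    (fun x y h => graph_homP g (graph_homP f h)).

Definition Graph : category.
Proof.
refine (@Category graph graph_hom graph_id graph_comp _ _ _).
- by move=> G H f; exact: graph_hom_ext.
- by move=> G H f; exact: graph_hom_ext.
- by move=> G H K L h g f; exact: graph_hom_ext.
Defined.

Section CompressedCommutingGraph.
Variable R : pzRingType.
Implicit Types a b : R.

(* The value q(a); horner is only available over rings with 1 != 0. *)
Definition int_eval (q : {poly int}) a : R :=
  \sum_(i < size q) a ^+ i *~ q`_i.

Definition gen1 a : set R := range (int_eval ^~ a).

Definition sim1 a b : Prop := gen1 a = gen1 b.

Definition class1 a : set R := [set b | sim1 a b].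

Definition vertex1 : Type := set_type (range class1).

Definition cls1 a : vertex1 := SigSub (mem_set (imageT class1 a)).

Definition adj1 (x y : vertex1) : Prop :=
  exists a b, [/\ x = cls1 a, y = cls1 b & a * b = b * a].

Lemma adj1_sym x y : adj1 x y -> adj1 y x.
Proof. by case=> a [b [-> -> ab]]; exists b, a. Qed.

Definition Lambda1 : graph := MkGraph adj1_sym.

Lemma gen1_id a : gen1 a a.
Proof.
exists 'X => //; rewrite /int_eval size_polyX !big_ord_recl big_ord0 /=.
by rewrite !coefX /= mulr0z mulr1z add0r addr0 expr1.
Qed.

Lemma cls1_eq a b : cls1 a = cls1 b -> sim1 a b.
Proof.
move=> /(congr1 val)/= ab.
by have : class1 b b by []; rewrite -ab.
Qed.

(* Adjacency does not depend on the representatives. *)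
Lemma adj1E a b : adj1 (cls1 a) (cls1 b) <-> a * b = b * a.
Proof.
split=> [[a' [b' [/cls1_eq aa' /cls1_eq bb' ab']]]|]; last by exists a, b.
have comm_eval q c d : GRing.comm c d -> GRing.comm c (int_eval q d).
  move=> cd; apply: commr_sum => i _.
  have := commrX i cd; rewrite /GRing.comm => h.
  by rewrite mulrzAr h mulrzAl.
have := gen1_id a; rewrite aa' => -[p _ <-].
have := gen1_id b; rewrite bb' => -[q _ <-].
by apply/comm_eval/commr_sym/comm_eval/commr_sym.
Qed.

End CompressedCommutingGraph.

Lemma int_evalE (R : nzRingType) (q : {poly int}) (a : R) :
  int_eval q a = (map_poly intr q).[a].
Proof.
by rewrite horner_poly; apply: eq_bigr => i _; rewrite mulrzl.
Qed.

(* Main.v *)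
(* A ring morphism f commutes with evaluation of integer polynomials, so it maps
   <a>_1 onto <f a>_1; hence a ~_1 b implies f a ~_1 f b. *)
Require Import Defs.
From HB Require Import structures.
From mathcomp Require Import all_boot all_algebra.
From mathcomp Require Import boolp classical_sets.

Import GRing.Theory.

(** Since $f(q(a)) = q(f(a))$ for integer polynomials $q$, the subring generated by $f(a)$ is
    determined by the one generated by $a$ ([gen1_rmorph]), so $[r]_1 \mapsto [f(r)]_1$ is well
    defined ([Lambda1_fun_cls1]). Commuting elements have commuting images, which preserves edges.
    Every vertex is the class of an element ([cls1_surj]), so the values on classes determine the
    map; this yields both uniqueness and the functor laws. *)

Lemma rmorph_int_eval (R S : pzRingType) (f : {rmorphism R -> S})
    (q : {poly int}) (a : R) : f (int_eval q a) = int_eval q (f a).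
Proof.
by rewrite rmorph_sum; apply: eq_bigr => i _; rewrite raddfMz -rmorphXn.
Qed.

Lemma gen1_rmorph (R S : pzRingType) (f : {rmorphism R -> S}) (a : R) :
  gen1 (f a) = image (gen1 a) f.
Proof.
by rewrite image_comp; apply: eq_imagel => q _; rewrite /= rmorph_int_eval.
Qed.

Lemma sim1_rmorph (R S : pzRingType) (f : {rmorphism R -> S}) (a b : R) :
  sim1 a b -> sim1 (f a) (f b).
Proof. by rewrite /sim1 !gen1_rmorph => ->. Qed.

Lemma cls1_sim1 (R : pzRingType) (a b : R) : sim1 a b -> cls1 a = cls1 b.
Proof.
by move=> ab; apply: val_inj; apply: funext => c; rewrite /= /class1 /mkset /sim1 ab.
Qed.

Lemma cls1_surj (R : pzRingType) (x : vertex1 R) : exists a, cls1 a = x.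
Proof. by have [a _ ax] := set_mem (valP x); exists a; apply: val_inj. Qed.

(** The representative comes from classical choice and is arbitrary within its class. *)
Definition repr1 (R : pzRingType) (x : vertex1 R) : R := sval (cid (cls1_surj R x)).

Lemma repr1K (R : pzRingType) : cancel (@repr1 R) (@cls1 R).
Proof. by move=> x; exact: svalP (cid (cls1_surj R x)). Qed.

Definition Lambda1_fun (R S : pzRingType) (f : {rmorphism R -> S})
  (x : Lambda1 R) : Lambda1 S := cls1 (f (repr1 R x)).

(** The element chosen from [cls1 r] may differ from [r], but it is [sim1]-equivalent to it, and [f]
    respects [sim1]; hence the choice leaves no trace. *)
Lemma Lambda1_fun_cls1 (R S : pzRingType) (f : {rmorphism R -> S}) (r : R) :
  Lambda1_fun R S f (cls1 r) = cls1 (f r).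
Proof. exact/cls1_sim1/sim1_rmorph/cls1_eq/repr1K. Qed.

Lemma Lambda1_fun_adj (R S : pzRingType) (f : {rmorphism R -> S})
    (x y : Lambda1 R) :
  adj x y -> adj (Lambda1_fun R S f x) (Lambda1_fun R S f y).
Proof.
move=> [a [b [-> -> ab]]]; exists (f a), (f b).
by rewrite !Lambda1_fun_cls1 -!rmorphM ab.
Qed.

Definition Lambda1_hom (R S : pzRingType) (f : {rmorphism R -> S}) :
  graph_hom (Lambda1 R) (Lambda1 S) := GraphHom (Lambda1_fun_adj R S f).

Theorem proposition5 :
  exists! Lambda1_map : (forall R S : pzRingType,
      {rmorphism R -> S} -> graph_hom (Lambda1 R) (Lambda1 S)),
    (forall (R S : pzRingType) (f : {rmorphism R -> S}) (r : R),
       Lambda1_map R S f (cls1 r) = cls1 (f r)) /\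
    @is_functor Ring1 Graph Lambda1 Lambda1_map.
Proof.
exists Lambda1_hom; split; last first.
  (* Uniqueness: a competing map takes the same value at each vertex, once that vertex is written as
     [cls1 a]. *)
  move=> F [F_cls1 _]; apply: functional_extensionality_dep => R.
  apply: functional_extensionality_dep => S; apply: funext => f.
  apply: graph_hom_ext => x; have [a <-] := cls1_surj R x.
  by rewrite F_cls1 /= Lambda1_fun_cls1.
split; first exact: Lambda1_fun_cls1.
(* On a vertex [cls1 a], each law reduces to the formula on classes. *)
split=> [R | R S T g f]; apply: graph_hom_ext => x; have [a <-] := cls1_surj R x.
  by rewrite /= Lambda1_fun_cls1.
by rewrite /= !Lambda1_fun_cls1.
Qed.
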